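(* Suppose $v \in C^2(\mathbb{R}^2, \mathbb{R}^3)$ is such that the map $u$ defined by $$u(x,y,t) = v\left(\frac{x}{t},\frac{y}{t}\right)$$ is a solution to the wave constant-mean-curvature equation $$(-\partial_t^2 + \Delta) u = 2\, u_x \wedge u_y \quad \text{on } \{(x,y,t) \in \mathbb{R}^2\times\mathbb{R} : t > 0\}.$$ Then $v$ is constant on $\mathbb{D}$, where $\mathbb{D}$ is the unit disc in $\mathbb{R}^2$.
   Context: Here $(x,y)$ are the coordinates on $\mathbb{R}^2$ and $t$ is the time coordinate. The map $u$ takes values in $\mathbb{R}^3$, $\Delta = \partial_x^2 + \partial_y^2$ is the Laplacian on $\mathbb{R}^2$ acting componentwise on the three components of $u$, $u_x = \partial_x u$, $u_y = \partial_y u$, and $u_x \wedge u_y$ is the cross product of the two vectors $u_x$ and $u_y$ in $\mathbb{R}^3$. *)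

(* Defs.v *)
From Stdlib Require Import Reals.
From Coquelicot Require Import Coquelicot.

Open Scope R_scope.

Definition R3 : Type := (R * R * R)%type.

Definition comp1 (p : R3) : R := fst (fst p).
Definition comp2 (p : R3) : R := snd (fst p).
Definition comp3 (p : R3) : R := snd p.

Definition add3 (p q : R3) : R3 :=
  (comp1 p + comp1 q, comp2 p + comp2 q, comp3 p + comp3 q).

Definition scal3 (a : R) (p : R3) : R3 :=
  (a * comp1 p, a * comp2 p, a * comp3 p).

Definition cross (p q : R3) : R3 :=
  (comp2 p * comp3 q - comp3 p * comp2 q,
   comp3 p * comp1 q - comp1 p * comp3 q,
   comp1 p * comp2 q - comp2 p * comp1 q).

Definition Derive3_n (g : R -> R3) (n : nat) (s : R) : R3 :=
  (Derive_n (fun r => comp1 (g r)) n s,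
   Derive_n (fun r => comp2 (g r)) n s,
   Derive_n (fun r => comp3 (g r)) n s).

Definition partial_x (n : nat) (u : R -> R -> R -> R3) (x y t : R) : R3 :=
  Derive3_n (fun s => u s y t) n x.
Definition partial_y (n : nat) (u : R -> R -> R -> R3) (x y t : R) : R3 :=
  Derive3_n (fun s => u x s t) n y.
Definition partial_t (n : nat) (u : R -> R -> R -> R3) (x y t : R) : R3 :=
  Derive3_n (fun s => u x y s) n t.

Definition laplacian (u : R -> R -> R -> R3) (x y t : R) : R3 :=
  add3 (partial_x 2 u x y t) (partial_y 2 u x y t).

(* [ex_diff_n f 2 x y] asks that f and its partial derivatives of order at
   most 2 exist and are jointly continuous at (x, y); required at every point,
   this is membership of f in C^2(R^2). *)
Definition C2_plane (v : R -> R -> R3) : Prop :=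
  forall x y : R,
    ex_diff_n (fun a b => comp1 (v a b)) 2 x y /\
    ex_diff_n (fun a b => comp2 (v a b)) 2 x y /\
    ex_diff_n (fun a b => comp3 (v a b)) 2 x y.

(* Derivatives are Coquelicot's total ones, so this equation is meaningful for
   u having the relevant partial derivatives on t > 0; [self_similar v] is C^2
   there as soon as v is C^2.  The values of u at t <= 0 are irrelevant. *)
Definition wave_cmc_solution (u : R -> R -> R -> R3) : Prop :=
  forall x y t : R, 0 < t ->
    add3 (scal3 (-1) (partial_t 2 u x y t)) (laplacian u x y t) =
    scal3 2 (cross (partial_x 1 u x y t) (partial_y 1 u x y t)).

Definition self_similar (v : R -> R -> R3) (x y t : R) : R3 :=
  v (x / t) (y / t).

Definition unit_disc (x y : R) : Prop := x ^ 2 + y ^ 2 < 1.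

(* Main.v *)
Require Import Defs.
From Stdlib Require Import Reals Lra Psatz Lia.
From Coquelicot Require Import Coquelicot.

(* Write [f (r, t) = v (r cos t, r sin t)].  The equation for [u] becomes
     [r^2 (1 - r^2) f_rr + (r - 2 r^3) f_r + f_tt = 2 r f_r x f_t].
   The right-hand side is orthogonal to [f_r], so integrating the scalar product with [f_r]
   over circles shows that [r^2 (1 - r^2) P - Q] is constant in [r], where [P] and [Q] are
   the integrals of [|f_r|^2] and [|f_t|^2]; the constant is [0], as seen at [r = 0].  At
   [r = 1] this gives [Q = 0], so [f] equals a constant [k] on the unit circle.

   Uniqueness from the boundary inwards: put [r = sech s] and let [h s] be the integral of
   [|f - k|^2] over the circle of radius [r].  By the equipartition [Q = r^2 (1 - r^2) P],
   Cauchy-Schwarz reads [h'^2 <= 4 h Q], while the equation gives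
   [h'' >= 4 Q - m S h - (4 / m) Q] for every [m >= 1], with [S = sup |f_r|^2].  Hence
   [p = h' / h] satisfies [p' >= - (1 + S) sqrt (1 + p^2)], which bounds [p] from above as
   [s] decreases to [0], and [h] could not vanish at [s = 0] unless [h = 0]. *)

(** * Twice differentiable functions of two variables *)

Definition continuous_2d (f : R -> R -> R) : Prop :=
  forall x y, continuity_2d_pt f x y.

(** Derivatives are carried as data instead of being computed with [Derive], so that a change of
    coordinates can supply closed formulas for them. The single field [j12] serves both orders of
    mixed differentiation. *)
Record jet : Type := Jet {
  j0 : R -> R -> R;
  j1 : R -> R -> R;
  j2 : R -> R -> R;
  j11 : R -> R -> R;
  j12 : R -> R -> R;
  j22 : R -> R -> R }.

Record is_jet (a : jet) : Prop := {
  j0_cont : continuous_2d (j0 a);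
  j1_cont : continuous_2d (j1 a);
  j2_cont : continuous_2d (j2 a);
  j11_cont : continuous_2d (j11 a);
  j12_cont : continuous_2d (j12 a);
  j22_cont : continuous_2d (j22 a);
  j0_d1 : forall x y, is_derive (fun s => j0 a s y) x (j1 a x y);
  j0_d2 : forall x y, is_derive (fun s => j0 a x s) y (j2 a x y);
  j1_d1 : forall x y, is_derive (fun s => j1 a s y) x (j11 a x y);
  j1_d2 : forall x y, is_derive (fun s => j1 a x s) y (j12 a x y);
  j2_d1 : forall x y, is_derive (fun s => j2 a s y) x (j12 a x y);
  j2_d2 : forall x y, is_derive (fun s => j2 a x s) y (j22 a x y) }.

Definition jet_of (f : R -> R -> R) : jet :=
  let d1 g x y := Derive (fun s => g s y) x in
  let d2 g x y := Derive (fun s => g x s) y in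
  Jet f (d1 f) (d2 f) (d1 (d1 f)) (d2 (d1 f)) (d2 (d2 f)).

(** All clauses but one come directly from [ex_diff_n]. Since [jet_of] takes for [j12] the
    [y]-derivative of the [x]-derivative, Schwarz's theorem is what identifies it with the
    [x]-derivative of [j2]. *)
Lemma is_jet_jet_of (f : R -> R -> R) :
  (forall x y, ex_diff_n f 2 x y) -> is_jet (jet_of f).
Proof.
  intros H.
  assert (Hsym : forall x y,
    Derive (fun s => Derive (fun r => f s r) y) x =
    Derive (fun s => Derive (fun r => f r s) x) y).
  { intros x y. apply Schwarz.
    - apply locally_2d_forall. intros u w.
      destruct (H u w) as (_ & ? & ? & (_ & ? & ? & _) & (_ & ? & ? & _)).
      tauto.
    - destruct (H x y) as (_ & _ & _ & _ & (_ & _ & _ & (? & _) & _)); assumption.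
    - destruct (H x y) as (_ & _ & _ & (_ & _ & _ & _ & (? & _)) & _); assumption. }
  split; unfold jet_of, continuous_2d; simpl; intros x y;
    pose proof (H x y) as
      (? & ? & ? & (? & ? & ? & (? & _) & (? & _)) & (? & ? & ? & (? & _) & (? & _)));
    try assumption; try (apply Derive_correct; assumption).
  rewrite <- Hsym. apply Derive_correct. assumption.
Qed.

(** Chain rule along a curve: existence of both partial derivatives together with continuity of [fx]
    makes [f] differentiable as a function of the pair. *)
Lemma is_derive_comp_2d (f fx fy : R -> R -> R) (al be : R -> R) (s da db : R) :
  (forall x y, is_derive (fun u => f u y) x (fx x y)) ->
  (forall x y, is_derive (fun u => f x u) y (fy x y)) ->
  continuous_2d fx ->
  is_derive al s da -> is_derive be s db ->
  is_derive (fun u => f (al u) (be u)) s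
    (fx (al s) (be s) * da + fy (al s) (be s) * db).
Proof.
  intros Hx Hy Hc Ha Hb.
  apply is_derive_Reals.
  apply derivable_pt_lim_comp_2d; try (apply is_derive_Reals; assumption).
  apply filterdiff_differentiable_pt_lim.
  apply (is_derive_filterdiff f (al s) (be s) fx).
  - apply filter_forall. intros; apply Hx.
  - apply Hy.
  - apply continuity_2d_pt_filterlim. apply Hc.
Qed.

Lemma continuous_2d_comp (f g h : R -> R -> R) :
  continuous_2d f -> continuous_2d g -> continuous_2d h ->
  continuous_2d (fun x y => f (g x y) (h x y)).
Proof.
  intros Hf Hg Hh x y.
  apply continuity_2d_pt_filterlim.
  apply (continuous_comp_2 (fun z : R * R => g (fst z) (snd z))
    (fun z : R * R => h (fst z) (snd z)) f (x, y)).
  - apply (continuity_2d_pt_filterlim g). apply Hg.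
  - apply (continuity_2d_pt_filterlim h). apply Hh.
  - apply (continuity_2d_pt_filterlim f). apply Hf.
Qed.

Lemma continuous_2d_const (c : R) : continuous_2d (fun _ _ => c).
Proof. intros x y; apply continuity_2d_pt_const. Qed.

Lemma continuous_2d_fst (f : R -> R) :
  (forall x, continuity_pt f x) -> continuous_2d (fun x _ => f x).
Proof.
  intros H x y. apply (continuity_1d_2d_pt_comp f (fun u _ => u)).
  apply H. apply continuity_2d_pt_id1.
Qed.

Lemma continuous_2d_snd (f : R -> R) :
  (forall x, continuity_pt f x) -> continuous_2d (fun _ y => f y).
Proof.
  intros H x y. apply (continuity_1d_2d_pt_comp f (fun _ u => u)).
  apply H. apply continuity_2d_pt_id2.
Qed.

Lemma continuous_2d_plus (f g : R -> R -> R) :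
  continuous_2d f -> continuous_2d g -> continuous_2d (fun x y => f x y + g x y).
Proof. intros ? ? x y; apply continuity_2d_pt_plus; auto. Qed.

Lemma continuous_2d_minus (f g : R -> R -> R) :
  continuous_2d f -> continuous_2d g -> continuous_2d (fun x y => f x y - g x y).
Proof. intros ? ? x y; apply continuity_2d_pt_minus; auto. Qed.

Lemma continuous_2d_opp (f : R -> R -> R) :
  continuous_2d f -> continuous_2d (fun x y => - f x y).
Proof. intros ? x y; apply continuity_2d_pt_opp; auto. Qed.

Lemma continuous_2d_mult (f g : R -> R -> R) :
  continuous_2d f -> continuous_2d g -> continuous_2d (fun x y => f x y * g x y).
Proof. intros ? ? x y; apply continuity_2d_pt_mult; auto. Qed.

Lemma continuous_2d_pow (f : R -> R -> R) (n : nat) :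
  continuous_2d f -> continuous_2d (fun x y => f x y ^ n).
Proof.
  intros Hf; induction n as [|n IH]; simpl.
  - apply continuous_2d_const.
  - apply (continuous_2d_mult f (fun x y => f x y ^ n)); assumption.
Qed.

Lemma continuous_2d_eta (f : R -> R -> R) :
  continuous_2d f -> continuous_2d (fun x y => f x y).
Proof. intros H; exact H. Qed.

Ltac cont2d :=
  match goal with
  | |- continuous_2d (fun x y => ?c) => apply continuous_2d_const
  | |- continuous_2d (fun x y => x) =>
      apply (continuous_2d_fst (fun u => u)); intro; apply continuity_pt_id
  | |- continuous_2d (fun x y => cos y) =>
      apply (continuous_2d_snd cos); intro; apply continuity_cos
  | |- continuous_2d (fun x y => sin y) =>
      apply (continuous_2d_snd sin); intro; apply continuity_sin
  | |- continuous_2d (fun x y => @?f x y + @?g x y) =>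
      apply (continuous_2d_plus f g); cbv beta; cont2d
  | |- continuous_2d (fun x y => @?f x y - @?g x y) =>
      apply (continuous_2d_minus f g); cbv beta; cont2d
  | |- continuous_2d (fun x y => - @?f x y) =>
      apply (continuous_2d_opp f); cbv beta; cont2d
  | |- continuous_2d (fun x y => @?f x y * @?g x y) =>
      apply (continuous_2d_mult f g); cbv beta; cont2d
  | |- continuous_2d (fun x y => @?f x y ^ ?n) =>
      apply (continuous_2d_pow f n); cbv beta; cont2d
  | |- continuous_2d (fun x y => ?f x y) =>
      apply (continuous_2d_eta f); auto using j0_cont, j1_cont, j2_cont,
        j11_cont, j12_cont, j22_cont
  | |- continuous_2d (fun x y => ?f (@?g x y) (@?h x y)) =>
      apply (continuous_2d_comp f g h); cbv beta; cont2d
  | |- continuous_2d _ =>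
      auto using j0_cont, j1_cont, j2_cont, j11_cont, j12_cont, j22_cont
  end.

(** Uniform continuity gives a step length over which [f] changes by less than [1]. Walking from the
    corner [(a, c)] to [(x, y)] in a fixed number [n] of equal steps then costs at most [n]. *)
Lemma continuous_2d_bounded (f : R -> R -> R) (a b c d : R) :
  continuous_2d f -> a <= b -> c <= d ->
  exists M, forall x y, a <= x <= b -> c <= y <= d -> Rabs (f x y) <= M.
Proof.
  intros Hf Hab Hcd.
  destruct (uniform_continuity_2d f a b c d (fun x y _ _ => Hf x y) (mkposreal 1 Rlt_0_1))
    as [e He]. simpl in He.
  (* The sum of the two side lengths bounds the displacement in either coordinate, so one number of
     steps serves both; the successor of the floor makes each step strictly shorter than [e]. *)
  destruct (nfloor_ex ((b - a + (d - c)) / e)) as [N HN].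
  { apply Rdiv_le_0_compat; [lra|apply cond_pos]. }
  set (n := S N).
  assert (Hn : 0 < INR n) by (apply lt_0_INR; unfold n; lia).
  assert (Hne : (b - a + (d - c)) < e * INR n).
  { apply Rmult_lt_reg_r with (/ e); [apply Rinv_0_lt_compat, cond_pos|].
    replace (e * INR n * / e) with (INR n) by (field; apply Rgt_not_eq, cond_pos).
    unfold n. rewrite S_INR. unfold Rdiv in HN. lra. }
  exists (Rabs (f a c) + INR n). intros x y Hx Hy.
  assert (Hstep : forall k, (k <= n)%nat ->
    Rabs (f (a + INR k * ((x - a) / INR n)) (c + INR k * ((y - c) / INR n)))
      <= Rabs (f a c) + INR k).
  { assert (Hin : forall k z lo hi, (k <= n)%nat -> lo <= z <= hi ->
      lo <= lo + INR k * ((z - lo) / INR n) <= hi).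
    { intros k z lo hi Hk Hz. apply le_INR in Hk. pose proof (pos_INR k).
      assert (0 <= (z - lo) / INR n) by (apply Rdiv_le_0_compat; lra).
      assert (INR n * ((z - lo) / INR n) = z - lo) by (field; lra).
      nra. }
    assert (Hd : forall k z lo w, 0 <= z - lo -> z - lo <= w -> w < e * INR n ->
      Rabs (lo + INR (S k) * ((z - lo) / INR n) - (lo + INR k * ((z - lo) / INR n))) < e).
    { intros k z lo w H1 H2 H3. rewrite S_INR.
      replace (lo + (INR k + 1) * ((z - lo) / INR n) - (lo + INR k * ((z - lo) / INR n)))
        with ((z - lo) / INR n) by ring.
      rewrite Rabs_pos_eq by (apply Rdiv_le_0_compat; lra).
      apply Rmult_lt_reg_r with (INR n); [assumption|].
      unfold Rdiv. rewrite Rmult_assoc, Rinv_l by lra. lra. }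
    intros k. induction k as [|k IH]; intros Hk.
    - rewrite !Rmult_0_l, !Rplus_0_r. apply Rle_refl.
    - specialize (IH ltac:(lia)).
      set (x1 := a + INR (S k) * _). set (y1 := c + INR (S k) * _).
      set (x0 := a + INR k * _) in *. set (y0 := c + INR k * _) in *.
      assert (Rabs (f x1 y1 - f x0 y0) < 1).
      { apply He; try (apply Hin; lia || lra).
        - apply (Hd k x a (b - a + (d - c))); lra.
        - apply (Hd k y c (b - a + (d - c))); lra. }
      rewrite S_INR.
      pose proof (Rabs_triang (f x1 y1 - f x0 y0) (f x0 y0)).
      replace (f x1 y1 - f x0 y0 + f x0 y0) with (f x1 y1) in * by ring. lra. }
  specialize (Hstep n (Nat.le_refl n)).
  replace (a + INR n * ((x - a) / INR n)) with x in Hstep by (field; lra).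
  replace (c + INR n * ((y - c) / INR n)) with y in Hstep by (field; lra).
  exact Hstep.
Qed.

(** * Polar coordinates and the reduced equation *)

Definition polar (f : R -> R -> R) (r t : R) : R := f (r * cos t) (r * sin t).

(** The fields are [f_r], [f_t], [f_rr], [f_rt], [f_tt] from the chain rule. Nothing is divided by
    [r], so the formulas hold for every real [r], including [0]. *)
Definition polar_jet (a : jet) : jet :=
  Jet (polar (j0 a))
    (fun r t => polar (j1 a) r t * cos t + polar (j2 a) r t * sin t)
    (fun r t => r * (polar (j2 a) r t * cos t - polar (j1 a) r t * sin t))
    (fun r t => polar (j11 a) r t * cos t ^ 2
       + 2 * (polar (j12 a) r t * (cos t * sin t)) + polar (j22 a) r t * sin t ^ 2)
    (fun r t => polar (j2 a) r t * cos t - polar (j1 a) r t * sin t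
       + r * ((polar (j22 a) r t - polar (j11 a) r t) * (cos t * sin t)
              + polar (j12 a) r t * (cos t ^ 2 - sin t ^ 2)))
    (fun r t => r ^ 2 * (polar (j11 a) r t * sin t ^ 2
       - 2 * (polar (j12 a) r t * (cos t * sin t)) + polar (j22 a) r t * cos t ^ 2)
       - r * (polar (j1 a) r t * cos t + polar (j2 a) r t * sin t)).

Lemma is_derive_value (f : R -> R) (x l l' : R) :
  is_derive f x l -> l = l' -> is_derive f x l'.
Proof. intros H <-; exact H. Qed.

Lemma polar_d1 (f fx fy : R -> R -> R) (r t : R) :
  (forall x y, is_derive (fun u => f u y) x (fx x y)) ->
  (forall x y, is_derive (fun u => f x u) y (fy x y)) ->
  continuous_2d fx ->
  is_derive (fun s => polar f s t) r (polar fx r t * cos t + polar fy r t * sin t).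
Proof.
  intros Hx Hy Hc.
  apply (is_derive_comp_2d f fx fy (fun s => s * cos t) (fun s => s * sin t)); auto;
    auto_derive; trivial; ring.
Qed.

Lemma polar_d2 (f fx fy : R -> R -> R) (r t : R) :
  (forall x y, is_derive (fun u => f u y) x (fx x y)) ->
  (forall x y, is_derive (fun u => f x u) y (fy x y)) ->
  continuous_2d fx ->
  is_derive (fun s => polar f r s) t
    (r * (polar fy r t * cos t - polar fx r t * sin t)).
Proof.
  intros Hx Hy Hc.
  eapply is_derive_value.
  - apply (is_derive_comp_2d f fx fy (fun s => r * cos s) (fun s => r * sin s)); auto;
      auto_derive; trivial; reflexivity.
  - unfold polar; ring.
Qed.

Lemma is_derive_plus_R (f g : R -> R) (x a b : R) :
  is_derive f x a -> is_derive g x b -> is_derive (fun s => f s + g s) x (a + b).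
Proof. exact (is_derive_plus f g x a b). Qed.

Lemma is_derive_mult_R (f g : R -> R) (x a b : R) :
  is_derive f x a -> is_derive g x b ->
  is_derive (fun s => f s * g s) x (a * g x + f x * b).
Proof.
  intros Hf Hg. apply (is_derive_mult f g x a b Hf Hg). intros; apply Rmult_comm.
Qed.

Lemma is_jet_polar (a : jet) : is_jet a -> is_jet (polar_jet a).
Proof.
  intros Ha.
  assert (H0 := fun r t => polar_d1 _ _ _ r t (j0_d1 _ Ha) (j0_d2 _ Ha) (j1_cont _ Ha)).
  assert (H0' := fun r t => polar_d2 _ _ _ r t (j0_d1 _ Ha) (j0_d2 _ Ha) (j1_cont _ Ha)).
  assert (H1 := fun r t => polar_d1 _ _ _ r t (j1_d1 _ Ha) (j1_d2 _ Ha) (j11_cont _ Ha)).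
  assert (H1' := fun r t => polar_d2 _ _ _ r t (j1_d1 _ Ha) (j1_d2 _ Ha) (j11_cont _ Ha)).
  assert (H2 := fun r t => polar_d1 _ _ _ r t (j2_d1 _ Ha) (j2_d2 _ Ha) (j12_cont _ Ha)).
  assert (H2' := fun r t => polar_d2 _ _ _ r t (j2_d1 _ Ha) (j2_d2 _ Ha) (j12_cont _ Ha)).
  assert (Hcos : forall t, is_derive cos t (- sin t)) by
    (intro; auto_derive; trivial; ring).
  assert (Hsin : forall t, is_derive sin t (cos t)) by
    (intro; auto_derive; trivial; ring).
  assert (Hconst : forall c x : R, is_derive (fun _ => c) x 0) by
    (intros; auto_derive; trivial; ring).
  assert (Hid : forall x : R, is_derive (fun s => s) x 1) by
    (intros; auto_derive; trivial; ring).
  split; simpl; try (unfold polar; cont2d); intros r t; auto.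
  - eapply is_derive_value.
    + apply is_derive_plus_R; apply is_derive_mult_R; auto.
    + cbv beta; ring.
  - eapply is_derive_value.
    + apply is_derive_plus_R; apply is_derive_mult_R; auto.
    + cbv beta; ring.
  - eapply is_derive_value.
    + apply is_derive_mult_R; [apply Hid|].
      apply (is_derive_minus (V := R_NormedModule)); apply is_derive_mult_R; auto.
    + cbv beta; unfold minus, plus, opp; simpl; ring.
  - eapply is_derive_value.
    + apply is_derive_mult_R; [apply Hconst|].
      apply (is_derive_minus (V := R_NormedModule)); apply is_derive_mult_R; auto.
    + cbv beta; unfold minus, plus, opp; simpl; ring.
Qed.

(** * The equation for the self-similar profile *)

Lemma Derive_n_2_value (f f1 : R -> R) (x l : R) :
  locally x (fun s => is_derive f s (f1 s)) -> is_derive f1 x l ->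
  Derive_n f 2 x = l.
Proof.
  intros H1 H2. simpl.
  rewrite (Derive_ext_loc _ f1).
  - apply is_derive_unique, H2.
  - apply filter_imp with (2 := H1). intros s Hs. apply is_derive_unique, Hs.
Qed.

(** The wave equation is read at [t = 1] only, where [u] and [v] coincide as functions on the
    plane. *)
Lemma self_similar_d1 (a : jet) (x y : R) (n : nat) :
  Derive_n (fun s => j0 a (s / 1) (y / 1)) n x = Derive_n (fun s => j0 a s y) n x.
Proof.
  apply Derive_n_ext. intros s. now rewrite !Rdiv_1_r.
Qed.

Lemma self_similar_d2 (a : jet) (x y : R) (n : nat) :
  Derive_n (fun s => j0 a (x / 1) (s / 1)) n y = Derive_n (fun s => j0 a x s) n y.
Proof.
  apply Derive_n_ext. intros s. now rewrite !Rdiv_1_r.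
Qed.

Lemma self_similar_dt2 (a : jet) (x y : R) : is_jet a ->
  Derive_n (fun s => j0 a (x / s) (y / s)) 2 1 =
  x ^ 2 * j11 a x y + 2 * (x * y) * j12 a x y + y ^ 2 * j22 a x y
  + 2 * (x * j1 a x y + y * j2 a x y).
Proof.
  intros Ha.
  assert (Hdiv : forall z s : R, 0 < s -> is_derive (fun r => z / r) s (- z / s ^ 2)).
  { intros z s Hs. auto_derive; [lra|]. field. lra. }
  apply (Derive_n_2_value _ (fun s =>
    j1 a (x / s) (y / s) * (- x / s ^ 2) + j2 a (x / s) (y / s) * (- y / s ^ 2))).
  (* The formula for the first derivative is established on the half-line [s > 0], a neighbourhood
     of [1]. *)
  - apply filter_imp with (fun s => 0 < s).
    + intros s Hs.
      apply (is_derive_comp_2d (j0 a) (j1 a) (j2 a) (fun r => x / r) (fun r => y / r));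
        auto using j0_d1, j0_d2, j1_cont.
    + apply (open_gt 0). lra.
  - assert (Hd : forall z : R, is_derive (fun s => - z / s ^ 2) 1 (2 * z)).
    { intros z. auto_derive; [lra|]. field. }
    eapply is_derive_value.
    + apply is_derive_plus_R; (apply is_derive_mult_R; [|apply Hd]).
      * apply (is_derive_comp_2d (j1 a) (j11 a) (j12 a) (fun r => x / r) (fun r => y / r));
          auto using j1_d1, j1_d2, j11_cont, Rlt_0_1.
      * apply (is_derive_comp_2d (j2 a) (j12 a) (j22 a) (fun r => x / r) (fun r => y / r));
          auto using j2_d1, j2_d2, j12_cont, Rlt_0_1.
    + cbv beta. rewrite !Rdiv_1_r. field.
Qed.

(** On the unit disc this is the Laplace-Beltrami operator of the Klein model of the hyperbolic
    plane, divided by [1 - x ^ 2 - y ^ 2]. *)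
Definition klein_op (a : jet) (x y : R) : R :=
  (1 - x ^ 2) * j11 a x y - 2 * (x * y) * j12 a x y + (1 - y ^ 2) * j22 a x y
  - 2 * (x * j1 a x y + y * j2 a x y).

Lemma wave_component (a : jet) (x y : R) : is_jet a ->
  -1 * Derive_n (fun s => j0 a (x / s) (y / s)) 2 1 +
  (Derive_n (fun s => j0 a (s / 1) (y / 1)) 2 x +
   Derive_n (fun s => j0 a (x / 1) (s / 1)) 2 y) = klein_op a x y.
Proof.
  intros Ha.
  rewrite self_similar_d1, self_similar_d2, self_similar_dt2 by assumption.
  rewrite (Derive_n_2_value (fun s => j0 a s y) (fun s => j1 a s y) x (j11 a x y)),
    (Derive_n_2_value (fun s => j0 a x s) (fun s => j2 a x s) y (j22 a x y));
    auto using j1_d1, j2_d2.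
  - unfold klein_op; ring.
  - apply filter_forall; auto using j0_d2.
  - apply filter_forall; auto using j0_d1.
Qed.

Lemma self_similar_d12 (a : jet) (x y : R) : is_jet a ->
  Derive_n (fun s => j0 a (s / 1) (y / 1)) 1 x = j1 a x y /\
  Derive_n (fun s => j0 a (x / 1) (s / 1)) 1 y = j2 a x y.
Proof.
  intros Ha. rewrite self_similar_d1, self_similar_d2.
  split; apply is_derive_unique; auto using j0_d1, j0_d2.
Qed.

Lemma klein_equation (v : R -> R -> R3) (a b c : jet) :
  is_jet a -> is_jet b -> is_jet c ->
  (forall x y, v x y = (j0 a x y, j0 b x y, j0 c x y)) ->
  wave_cmc_solution (self_similar v) ->
  forall x y,
    klein_op a x y = 2 * (j1 b x y * j2 c x y - j1 c x y * j2 b x y) /\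
    klein_op b x y = 2 * (j1 c x y * j2 a x y - j1 a x y * j2 c x y) /\
    klein_op c x y = 2 * (j1 a x y * j2 b x y - j1 b x y * j2 a x y).
Proof.
  intros Ha Hb Hc Hv Hu x y.
  assert (E := Hu x y 1 Rlt_0_1).
  unfold laplacian, partial_t, partial_x, partial_y, self_similar, Derive3_n in E.
  assert (E1 : forall n (g h : R -> R) z,
     Derive_n (fun r => comp1 (v (g r) (h r))) n z =
     Derive_n (fun r => j0 a (g r) (h r)) n z).
  { intros. apply Derive_n_ext. intros; now rewrite Hv. }
  assert (E2 : forall n (g h : R -> R) z,
     Derive_n (fun r => comp2 (v (g r) (h r))) n z =
     Derive_n (fun r => j0 b (g r) (h r)) n z).
  { intros. apply Derive_n_ext. intros; now rewrite Hv. }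
  assert (E3 : forall n (g h : R -> R) z,
     Derive_n (fun r => comp3 (v (g r) (h r))) n z =
     Derive_n (fun r => j0 c (g r) (h r)) n z).
  { intros. apply Derive_n_ext. intros; now rewrite Hv. }
  rewrite !(E1 _ (fun s => s / 1) (fun _ => y / 1)), !(E1 _ (fun _ => x / 1) (fun s => s / 1)),
    !(E1 _ (fun s => x / s) (fun s => y / s)),
    !(E2 _ (fun s => s / 1) (fun _ => y / 1)), !(E2 _ (fun _ => x / 1) (fun s => s / 1)),
    !(E2 _ (fun s => x / s) (fun s => y / s)),
    !(E3 _ (fun s => s / 1) (fun _ => y / 1)), !(E3 _ (fun _ => x / 1) (fun s => s / 1)),
    !(E3 _ (fun s => x / s) (fun s => y / s)) in E.
  unfold add3, scal3, cross in E.
  cbv [comp1 comp2 comp3 fst snd] in E.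
  rewrite !wave_component in E by assumption.
  destruct (self_similar_d12 a x y Ha) as [A1 A2].
  destruct (self_similar_d12 b x y Hb) as [B1 B2].
  destruct (self_similar_d12 c x y Hc) as [C1 C2].
  rewrite A1, A2, B1, B2, C1, C2 in E.
  injection E as -> -> ->. repeat split; ring.
Qed.

(** The polar form of [klein_op] multiplied by [r ^ 2], which clears the denominators at the
    origin. *)
Definition polar_op (a : jet) (r t : R) : R :=
  r ^ 2 * (1 - r ^ 2) * j11 a r t + (r - 2 * r ^ 3) * j1 a r t + j22 a r t.

Lemma polar_op_polar_jet (a : jet) (r t : R) :
  polar_op (polar_jet a) r t = r ^ 2 * klein_op a (r * cos t) (r * sin t).
Proof.
  assert (Hcs : sin t ^ 2 = 1 - cos t ^ 2).
  { rewrite <- !Rsqr_pow2, sin2. reflexivity. }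
  unfold polar_op, klein_op; cbn [polar_jet j0 j1 j2 j11 j12 j22]; unfold polar.
  set (A := j11 a _ _). set (B := j12 a _ _). set (C := j22 a _ _).
  set (D := j1 a _ _). set (E := j2 a _ _).
  replace ((r * sin t) ^ 2) with (r ^ 2 * (1 - cos t ^ 2)) by (rewrite <- Hcs; ring).
  rewrite Hcs. ring.
Qed.

Definition polar_cross (b c : jet) (r t : R) : R :=
  j1 b r t * j2 c r t - j1 c r t * j2 b r t.

(** The factor [r] is the Jacobian determinant of polar coordinates. *)
Lemma polar_cross_polar_jet (b c : jet) (r t : R) :
  polar_cross (polar_jet b) (polar_jet c) r t =
  r * (j1 b (r * cos t) (r * sin t) * j2 c (r * cos t) (r * sin t)
       - j1 c (r * cos t) (r * sin t) * j2 b (r * cos t) (r * sin t)).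
Proof.
  assert (Hcs : sin t ^ 2 = 1 - cos t ^ 2).
  { rewrite <- !Rsqr_pow2, sin2. reflexivity. }
  unfold polar_cross; cbn [polar_jet j1 j2]; unfold polar.
  set (A := j1 b _ _). set (B := j1 c _ _). set (C := j2 b _ _). set (D := j2 c _ _).
  transitivity (r * ((A * D - B * C) * (cos t ^ 2 + sin t ^ 2))); [ring|].
  rewrite Hcs. ring.
Qed.

(** * Unique continuation for nearly log-convex functions *)

Lemma is_derive_nondecreasing (f df : R -> R) (a b : R) :
  a <= b -> (forall x, a <= x <= b -> is_derive f x (df x)) ->
  (forall x, a <= x <= b -> 0 <= df x) -> f a <= f b.
Proof.
  intros Hab Hd Hp.
  destruct (MVT_gen f a b df) as (c & Hc & E).
  - intros x Hx. rewrite Rmin_left, Rmax_right in Hx by lra. apply Hd; lra.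
  - intros x Hx. rewrite Rmin_left, Rmax_right in Hx by lra.
    apply derivable_continuous_pt. exists (df x). apply is_derive_Reals, Hd; lra.
  - rewrite Rmin_left, Rmax_right in Hc by lra.
    specialize (Hp c Hc). nra.
Qed.

(** With [h1 = h'] and [h2 = h''], the right-hand side of the conclusion is [p']; the shift by [eps]
    keeps [p] defined where [h] vanishes. The condition on all [q] is a division-free form of
    [h1 ^ 2 <= 4 * e * h]. *)
Lemma log_convexity_pointwise (h h1 h2 e S eps : R) :
  0 <= h -> 0 < eps -> 0 <= S ->
  (forall q, 0 <= e + q * h1 + q ^ 2 * h) ->
  (forall m, 1 <= m -> 4 * e - m * S * h - 4 / m * e <= h2) ->
  let p := h1 / (h + eps) in
  - (1 + S) * sqrt (p ^ 2 + 1) <= h2 / (h + eps) - p ^ 2.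
Proof.
  intros Hh Heps HS Hq Hm p.
  set (k := h + eps). assert (Hk : 0 < k) by (unfold k; lra).
  assert (Hh1 : h1 = p * k) by (unfold p; fold k; field; lra).
  (* This [m] balances the two losses: [p ^ 2 / m <= m], so that together they cost at most
     [(1 + S) * m]. *)
  set (m := sqrt (p ^ 2 + 1)).
  assert (Hm2 : m ^ 2 = p ^ 2 + 1) by (apply pow2_sqrt; nra).
  assert (Hm1 : 1 <= m).
  { unfold m. rewrite <- sqrt_1 at 1. apply sqrt_le_1_alt. nra. }
  (* The value [q = - p / 2] is the minimizer of the quadratic with [h] replaced by [h + eps]; the
     surplus [p ^ 2 * eps] has the right sign. *)
  assert (He : p ^ 2 * k <= 4 * e).
  { specialize (Hq (- p / 2)). rewrite Hh1 in Hq.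
    assert (0 <= p ^ 2 * eps) by (apply Rmult_le_pos; [apply pow2_ge_0|lra]).
    unfold k in *. nra. }
  specialize (Hm m Hm1).
  assert (Hi : 0 < / m <= 1).
  { split; [apply Rinv_0_lt_compat; lra|]. rewrite <- Rinv_1.
    apply Rinv_le_contravar; lra. }
  assert (H2 : (1 - / m) * (p ^ 2 * k) - m * S * k <= h2).
  { apply Rle_trans with (2 := Hm).
    assert ((1 - / m) * (p ^ 2 * k) <= (1 - / m) * (4 * e))
      by (apply Rmult_le_compat_l; lra).
    assert (0 <= m * S * eps).
    { apply Rmult_le_pos; [apply Rmult_le_pos|]; lra. }
    unfold Rdiv, k in *. nra. }
  assert (H3 : (1 - / m) * p ^ 2 - m * S <= h2 / k).
  { apply Rmult_le_reg_r with k; [assumption|].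
    unfold Rdiv. rewrite Rmult_assoc, Rinv_l, Rmult_1_r by lra. nra. }
  assert (H4 : / m * p ^ 2 <= m).
  { apply Rmult_le_reg_l with m; [lra|].
    rewrite <- Rmult_assoc, Rinv_r, Rmult_1_l by lra. nra. }
  nra.
Qed.

(* The differential inequality bounds [p = h'/(h + eps)] from above on [[0, T]] by a
   constant independent of [eps], so [h + eps] cannot drop from [h T] to [eps]. *)
Lemma log_convex_unique_continuation (h h1 h2 e : R -> R) (S : R) :
  (forall t, is_derive h t (h1 t)) ->
  (forall t, is_derive h1 t (h2 t)) ->
  (forall t, 0 <= h t) -> 0 <= S ->
  (forall t q, 0 <= t -> 0 <= e t + q * h1 t + q ^ 2 * h t) ->
  (forall t m, 0 <= t -> 1 <= m -> 4 * e t - m * S * h t - 4 / m * e t <= h2 t) ->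
  h 0 = 0 -> forall T, 0 <= T -> h T = 0.
Proof.
  intros Hd1 Hd2 Hh HS Hq Hm H0 T HT.
  destruct (Rle_lt_or_eq_dec 0 (h T) (Hh T)) as [Hpos|]; [exfalso|congruence].
  (* Integrating [p' >= - (1 + S) * sqrt (p ^ 2 + 1)] backwards from [T] gives this bound;
     [Rabs (h1 T) / h T] dominates [p T] for every [eps]. *)
  set (B := sinh (arcsinh (Rabs (h1 T) / h T) + (1 + S) * T)).
  assert (Hp : forall eps t, 0 < eps -> 0 <= t <= T -> h1 t / (h t + eps) <= B).
  { intros eps t Heps Ht.
    set (p := fun s => h1 s / (h s + eps)).
    assert (Hk : forall s, 0 < h s + eps) by (intros s; specialize (Hh s); lra).
    assert (Hpd : forall s, is_derive p s (h2 s / (h s + eps) - p s ^ 2)).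
    { intros s. eapply is_derive_value.
      - apply (is_derive_div h1 (fun s => h s + eps) s (h2 s) (h1 s + 0)).
        + apply Hd2.
        + apply is_derive_plus_R; [apply Hd1|]. auto_derive; trivial.
        + apply Rgt_not_eq, Hk.
      - unfold p. field. apply Rgt_not_eq, Hk. }
    (* The derivative of [arcsinh p] is [p' / sqrt (p ^ 2 + 1)], hence at least [- (1 + S)]. *)
    assert (Hmono : arcsinh (p t) + (1 + S) * t <= arcsinh (p T) + (1 + S) * T).
    { apply (is_derive_nondecreasing (fun s => arcsinh (p s) + (1 + S) * s)
        (fun s => (h2 s / (h s + eps) - p s ^ 2) * / sqrt (p s ^ 2 + 1) + (1 + S))); [lra| |].
      - intros s _. apply is_derive_plus_R.
        + apply (is_derive_comp arcsinh p s); [|apply Hpd].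
          apply is_derive_Reals, derivable_pt_lim_arcsinh.
        + auto_derive; trivial; ring.
      - intros s Hs.
        pose proof (log_convexity_pointwise (h s) (h1 s) (h2 s) (e s) S eps (Hh s) Heps HS
          (fun q => Hq s q ltac:(lra)) (fun m => Hm s m ltac:(lra))) as Hl.
        cbv zeta in Hl. fold (p s) in Hl.
        assert (Hs0 : 0 < sqrt (p s ^ 2 + 1)) by (apply sqrt_lt_R0; nra).
        apply Rmult_le_reg_r with (sqrt (p s ^ 2 + 1)); [assumption|].
        rewrite Rmult_plus_distr_r, (Rmult_assoc _ (/ _)), Rinv_l by lra. lra. }
    assert (HpT : p T <= Rabs (h1 T) / h T).
    { unfold p, Rdiv. apply Rle_trans with (Rabs (h1 T) * / (h T + eps)).
      - apply Rmult_le_compat_r; [left; apply Rinv_0_lt_compat, Hk|apply Rle_abs].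
      - apply Rmult_le_compat_l; [apply Rabs_pos|]. apply Rinv_le_contravar; lra. }
    apply arcsinh_le in HpT.
    fold (p t). rewrite <- (sinh_arcsinh (p t)). unfold B.
    assert (Hle : arcsinh (p t) <= arcsinh (Rabs (h1 T) / h T) + (1 + S) * T) by nra.
    destruct Hle as [Hlt|Heq]; [left; apply sinh_lt, Hlt|rewrite Heq; apply Rle_refl]. }
  (* Since [h' <= B * (h + eps)], the function [(h + eps) * exp (- B * s)] is nonincreasing, and it
     starts at [eps] because [h 0 = 0]. *)
  assert (Hlow : forall eps, 0 < eps -> h T * exp (- B * T) <= eps).
  { intros eps Heps.
    assert (Hmono := is_derive_nondecreasing
      (fun s => - ((h s + eps) * exp (- B * s)))
      (fun s => - (h1 s * exp (- B * s) + (h s + eps) * (- B * exp (- B * s)))) 0 T HT).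
    cbv beta in Hmono. rewrite H0, Rmult_0_r, exp_0 in Hmono.
    assert (HE := exp_pos (- B * T)).
    assert (- ((0 + eps) * 1) <= - ((h T + eps) * exp (- B * T))); [|nra].
    apply Hmono.
    - intros s _. apply (is_derive_opp (V := R_NormedModule)).
      apply (is_derive_mult_R (fun s => h s + eps) (fun s => exp (- B * s))).
      + eapply is_derive_value.
        * apply is_derive_plus_R; [apply Hd1|].
          apply (is_derive_const (V := R_NormedModule)).
        * apply Rplus_0_r.
      + auto_derive; trivial; ring.
    - intros s Hs. specialize (Hp eps s Heps Hs).
      assert (Hk : 0 < h s + eps) by (specialize (Hh s); lra).
      assert (h1 s <= B * (h s + eps)).
      { apply Rmult_le_reg_r with (/ (h s + eps)); [apply Rinv_0_lt_compat, Hk|].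
        rewrite (Rmult_assoc B), Rinv_r by lra. unfold Rdiv in Hp. lra. }
      assert (HEs := exp_pos (- B * s)). nra. }
  assert (Hc : 0 < h T * exp (- B * T)) by (apply Rmult_lt_0_compat; [assumption|apply exp_pos]).
  specialize (Hlow (h T * exp (- B * T) / 2)). lra.
Qed.

(** * Integrals over circles *)

Definition circ (g : R -> R) : R := RInt g (- PI) PI.

Lemma continuous_2d_slice (f : R -> R -> R) (r t : R) :
  continuous_2d f -> continuous (f r) t.
Proof.
  intros Hf.
  apply (continuous_comp_2 (fun _ : R => r) (fun s : R => s) f t).
  - apply continuous_const.
  - apply continuous_id.
  - apply (continuity_2d_pt_filterlim f). apply Hf.
Qed.

Lemma ex_RInt_slice (f : R -> R -> R) (r a b : R) :
  continuous_2d f -> ex_RInt (f r) a b.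
Proof.
  intros Hf. apply (ex_RInt_continuous (V := R_CompleteNormedModule)).
  intros; now apply continuous_2d_slice.
Qed.

Lemma circ_ext (f g : R -> R) : (forall t, f t = g t) -> circ f = circ g.
Proof. intros H; apply RInt_ext; intros; apply H. Qed.

Lemma circ_plus (f g : R -> R -> R) (r : R) :
  continuous_2d f -> continuous_2d g ->
  circ (fun t => f r t + g r t) = circ (f r) + circ (g r).
Proof.
  intros Hf Hg. apply (RInt_plus (V := R_CompleteNormedModule) (f r) (g r));
    now apply ex_RInt_slice.
Qed.

Lemma circ_scal (f : R -> R -> R) (r c : R) :
  continuous_2d f -> circ (fun t => c * f r t) = c * circ (f r).
Proof.
  intros Hf. apply (RInt_scal (V := R_CompleteNormedModule) (f r));
    now apply ex_RInt_slice.
Qed.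

Lemma circ_le (f g : R -> R -> R) (r : R) :
  continuous_2d f -> continuous_2d g ->
  (forall t, - PI <= t <= PI -> f r t <= g r t) -> circ (f r) <= circ (g r).
Proof.
  intros Hf Hg H. pose proof PI_RGT_0.
  apply RInt_le; try now apply ex_RInt_slice.
  - lra.
  - intros; apply H; lra.
Qed.

Lemma circ_0 : circ (fun _ => 0) = 0.
Proof. unfold circ. rewrite RInt_const. apply Rmult_0_r. Qed.

Lemma circ_ge_0 (f : R -> R -> R) (r : R) :
  continuous_2d f -> (forall t, 0 <= f r t) -> 0 <= circ (f r).
Proof.
  intros Hf H. rewrite <- circ_0.
  apply (circ_le (fun _ _ => 0) f r); auto. apply continuous_2d_const.
Qed.

(** A positive value persists on a small interval, whose positive contribution cannot be cancelled
    by the rest of a nonnegative integrand. *)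
Lemma circ_eq_0_interior (f : R -> R -> R) (r : R) :
  continuous_2d f -> (forall t, 0 <= f r t) -> circ (f r) = 0 ->
  forall t, - PI < t < PI -> f r t = 0.
Proof.
  intros Hf H H0 t Ht.
  destruct (Rle_lt_or_eq_dec 0 (f r t) (H t)) as [Hp|]; [exfalso|congruence].
  assert (Hl : locally t (fun s => 0 < f r s)).
  { apply (continuous_2d_slice f r t Hf (fun y => 0 < y)).
    apply (open_gt 0). exact Hp. }
  destruct Hl as [d Hd].
  (* The halves keep [[t - e, t + e]] strictly inside both the ball of radius [d] and the interval
     of integration. *)
  set (e := Rmin (d / 2) (Rmin ((t + PI) / 2) ((PI - t) / 2))).
  assert (He : 0 < e /\ e <= d / 2 /\ e <= (t + PI) / 2 /\ e <= (PI - t) / 2).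
  { assert (Hd0 := cond_pos d). unfold e.
    pose proof (Rmin_l (d / 2) (Rmin ((t + PI) / 2) ((PI - t) / 2))).
    pose proof (Rmin_r (d / 2) (Rmin ((t + PI) / 2) ((PI - t) / 2))).
    pose proof (Rmin_l ((t + PI) / 2) ((PI - t) / 2)).
    pose proof (Rmin_r ((t + PI) / 2) ((PI - t) / 2)).
    repeat split; try lra.
    repeat apply Rmin_glb_lt; lra. }
  assert (E : circ (f r) = RInt (f r) (- PI) (t - e) +
     (RInt (f r) (t - e) (t + e) + RInt (f r) (t + e) PI)).
  { assert (Hch : forall a b c, RInt (f r) a b + RInt (f r) b c = RInt (f r) a c).
    { intros. apply (RInt_Chasles (V := R_CompleteNormedModule)); now apply ex_RInt_slice. }
    unfold circ. now rewrite !Hch. }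
  assert (0 <= RInt (f r) (- PI) (t - e)).
  { apply RInt_ge_0; auto; [lra|now apply ex_RInt_slice]. }
  assert (0 <= RInt (f r) (t + e) PI).
  { apply RInt_ge_0; auto; [lra|now apply ex_RInt_slice]. }
  assert (0 < RInt (f r) (t - e) (t + e)).
  { apply RInt_gt_0; [lra| |intros; now apply continuous_2d_slice].
    intros s Hs. apply Hd. apply Rabs_lt_between'. simpl. lra. }
  lra.
Qed.

(** The endpoints are reached by continuity: a positive value at [t] would give one at the interior
    point [t * (1 - l)] for small [l]. *)
Lemma circ_eq_0 (f : R -> R -> R) (r : R) :
  continuous_2d f -> (forall t, 0 <= f r t) -> circ (f r) = 0 ->
  forall t, - PI <= t <= PI -> f r t = 0.
Proof.
  intros Hf H H0 t Ht.
  destruct (Rle_lt_or_eq_dec 0 (f r t) (H t)) as [Hp|]; [exfalso|congruence].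
  assert (Hl : locally t (fun s => 0 < f r s)).
  { apply (continuous_2d_slice f r t Hf (fun y => 0 < y)).
    apply (open_gt 0). exact Hp. }
  destruct Hl as [d Hd]. assert (Hd0 := cond_pos d). pose proof PI_RGT_0.
  set (l := Rmin (/ 2) (d / (2 * PI))).
  assert (Hl : 0 < l <= / 2 /\ l * PI < d).
  { assert (A1 : 0 < d / (2 * PI)) by (apply Rdiv_lt_0_compat; lra).
    assert (A2 : d / (2 * PI) * PI = d / 2) by (field; lra).
    assert (A3 : l <= / 2) by apply Rmin_l.
    assert (A4 : l <= d / (2 * PI)) by apply Rmin_r.
    assert (A5 : 0 < l) by (apply Rmin_glb_lt; lra).
    split; [lra|].
    apply Rle_lt_trans with (d / (2 * PI) * PI); [apply Rmult_le_compat_r|]; lra. }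
  assert (Hs : 0 < f r (t * (1 - l))).
  { apply Hd. apply Rabs_lt_between'. simpl.
    assert (t - d < t - l * PI) by lra. assert (t + l * PI < t + d) by lra. nra. }
  rewrite (circ_eq_0_interior f r Hf H H0) in Hs; [lra|nra].
Qed.

Lemma is_derive_circ (f df : R -> R -> R) (r : R) :
  continuous_2d f -> continuous_2d df ->
  (forall s t, is_derive (fun u => f u t) s (df s t)) ->
  is_derive (fun s => circ (f s)) r (circ (df r)).
Proof.
  intros Hf Hdf Hd. unfold circ.
  rewrite <- (RInt_ext (fun t => Derive (fun u => f u t) r))
    by (intros; apply is_derive_unique, Hd).
  apply (is_derive_RInt_param f).
  - apply filter_forall. intros s t _. exists (df s t). apply Hd.
  - intros t _. apply (continuity_2d_pt_ext df); [|apply Hdf].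
    intros; symmetry; apply is_derive_unique, Hd.
  - apply filter_forall. intros. now apply ex_RInt_slice.
Qed.

Lemma circ_derive (f df : R -> R -> R) (r : R) :
  continuous_2d df -> (forall t, is_derive (f r) t (df r t)) ->
  f r (- PI) = f r PI -> circ (df r) = 0.
Proof.
  intros Hc Hd Hp. unfold circ.
  erewrite is_RInt_unique.
  2:{ apply (is_RInt_derive (V := R_CompleteNormedModule) (f r)); intros.
      - apply Hd.
      - now apply continuous_2d_slice. }
  rewrite Hp. apply (minus_eq_zero (G := R_AbelianGroup)).
Qed.

(** * Energies on circles and integration by parts *)

Record periodic (a : jet) : Prop := {
  j0_periodic : forall r, j0 a r (- PI) = j0 a r PI;
  j1_periodic : forall r, j1 a r (- PI) = j1 a r PI;
  j2_periodic : forall r, j2 a r (- PI) = j2 a r PI }.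

(** One component each of the [h], [P] and [Q] of the overview, as functions of the radius. The
    measure is [dt], without the factor [r] of arc length. *)
Definition mass (a : jet) (r : R) : R := circ (fun t => j0 a r t ^ 2).
Definition radial_energy (a : jet) (r : R) : R := circ (fun t => j1 a r t ^ 2).
Definition angular_energy (a : jet) (r : R) : R := circ (fun t => j2 a r t ^ 2).

Lemma is_derive_pow2 (f : R -> R) (x l : R) :
  is_derive f x l -> is_derive (fun s => f s ^ 2) x (2 * (f x * l)).
Proof.
  intros H. eapply is_derive_value.
  - apply (is_derive_ext (fun s => f s * f s)); [intros; simpl; ring|].
    apply (is_derive_mult_R f f); exact H.
  - ring.
Qed.

Lemma is_derive_radial_energy (a : jet) (r : R) : is_jet a ->
  is_derive (radial_energy a) r (circ (fun t => 2 * (j1 a r t * j11 a r t))).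
Proof.
  intros Ha.
  apply (is_derive_circ (fun r t => j1 a r t ^ 2) (fun r t => 2 * (j1 a r t * j11 a r t)));
    try cont2d.
  intros s t. apply (is_derive_pow2 (fun u => j1 a u t)). now apply j1_d1.
Qed.

Lemma is_derive_angular_energy (a : jet) (r : R) : is_jet a ->
  is_derive (angular_energy a) r (circ (fun t => 2 * (j2 a r t * j12 a r t))).
Proof.
  intros Ha.
  apply (is_derive_circ (fun r t => j2 a r t ^ 2) (fun r t => 2 * (j2 a r t * j12 a r t)));
    try cont2d.
  intros s t. apply (is_derive_pow2 (fun u => j2 a u t)). now apply j2_d1.
Qed.

Lemma is_derive_mass (a : jet) (r : R) : is_jet a ->
  is_derive (mass a) r (circ (fun t => 2 * (j0 a r t * j1 a r t))).
Proof.
  intros Ha.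
  apply (is_derive_circ (fun r t => j0 a r t ^ 2) (fun r t => 2 * (j0 a r t * j1 a r t)));
    try cont2d.
  intros s t. apply (is_derive_pow2 (fun u => j0 a u t)). now apply j0_d1.
Qed.

Lemma is_derive_mass_2 (a : jet) (r : R) : is_jet a ->
  is_derive (fun s => circ (fun t => 2 * (j0 a s t * j1 a s t))) r
    (2 * radial_energy a r + 2 * circ (fun t => j0 a r t * j11 a r t)).
Proof.
  intros Ha. eapply is_derive_value.
  - apply (is_derive_circ (fun r t => 2 * (j0 a r t * j1 a r t))
      (fun r t => 2 * j1 a r t ^ 2 + 2 * (j0 a r t * j11 a r t))); try cont2d.
    intros s t. eapply is_derive_value.
    + apply is_derive_mult_R.
      * apply (is_derive_const (V := R_NormedModule)).
      * apply (is_derive_mult_R (fun u => j0 a u t) (fun u => j1 a u t)).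
        -- now apply j0_d1.
        -- now apply j1_d1.
    + cbv beta. unfold zero; simpl. ring.
  - unfold radial_energy.
    rewrite (circ_plus (fun r t => 2 * j1 a r t ^ 2) (fun r t => 2 * (j0 a r t * j11 a r t)))
      by cont2d.
    rewrite (circ_scal (fun r t => j1 a r t ^ 2)),
      (circ_scal (fun r t => j0 a r t * j11 a r t)) by cont2d.
    reflexivity.
Qed.

Lemma circ_parts_0 (a : jet) (r : R) : is_jet a -> periodic a ->
  circ (fun t => j0 a r t * j22 a r t) = - angular_energy a r.
Proof.
  intros Ha Hp.
  assert (H : circ (fun t => j2 a r t ^ 2 + j0 a r t * j22 a r t) = 0).
  { apply (circ_derive (fun r t => j0 a r t * j2 a r t)
      (fun r t => j2 a r t ^ 2 + j0 a r t * j22 a r t)); [cont2d| |].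
    - intros t. eapply is_derive_value.
      + apply (is_derive_mult_R (j0 a r) (j2 a r)); [now apply j0_d2|now apply j2_d2].
      + ring.
    - now rewrite j0_periodic, j2_periodic. }
  rewrite (circ_plus (fun r t => j2 a r t ^ 2) (fun r t => j0 a r t * j22 a r t)) in H
    by cont2d.
  unfold angular_energy. lra.
Qed.

(** Integration by parts, the boundary terms [f_r f_t] cancelling by periodicity. The right-hand
    side is minus half the radial derivative of [angular_energy]. *)
Lemma circ_parts_1 (a : jet) (r : R) : is_jet a -> periodic a ->
  circ (fun t => j1 a r t * j22 a r t) = - circ (fun t => j2 a r t * j12 a r t).
Proof.
  intros Ha Hp.
  assert (H : circ (fun t => j2 a r t * j12 a r t + j1 a r t * j22 a r t) = 0).
  { apply (circ_derive (fun r t => j1 a r t * j2 a r t)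
      (fun r t => j2 a r t * j12 a r t + j1 a r t * j22 a r t)); [cont2d| |].
    - intros t. eapply is_derive_value.
      + apply (is_derive_mult_R (j1 a r) (j2 a r)); [now apply j1_d2|now apply j2_d2].
      + ring.
    - now rewrite j1_periodic, j2_periodic. }
  rewrite (circ_plus (fun r t => j2 a r t * j12 a r t) (fun r t => j1 a r t * j22 a r t)) in H
    by cont2d.
  lra.
Qed.

Lemma circ_polar_op (a : jet) (g : R -> R -> R) (r : R) : is_jet a -> continuous_2d g ->
  circ (fun t => g r t * polar_op a r t) =
  r ^ 2 * (1 - r ^ 2) * circ (fun t => g r t * j11 a r t)
  + (r - 2 * r ^ 3) * circ (fun t => g r t * j1 a r t)
  + circ (fun t => g r t * j22 a r t).
Proof.
  intros Ha Hg.
  rewrite <- (circ_scal (fun r t => g r t * j11 a r t)),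
    <- (circ_scal (fun r t => g r t * j1 a r t)) by cont2d.
  rewrite <- (circ_plus (fun s t => r ^ 2 * (1 - r ^ 2) * (g s t * j11 a s t))
    (fun s t => (r - 2 * r ^ 3) * (g s t * j1 a s t))) by cont2d.
  rewrite <- (circ_plus (fun s t => r ^ 2 * (1 - r ^ 2) * (g s t * j11 a s t)
    + (r - 2 * r ^ 3) * (g s t * j1 a s t)) (fun s t => g s t * j22 a s t)) by cont2d.
  apply circ_ext. intros t. unfold polar_op. ring.
Qed.

(** The first-order coefficient [r - 2 * r ^ 3] is half the derivative of [r ^ 2 * (1 - r ^ 2)], so
    multiplying [polar_op] by [2 f_r] and integrating produces an exact derivative. *)
Lemma is_derive_energy_difference (a : jet) (r : R) : is_jet a -> periodic a ->
  is_derive (fun s => s ^ 2 * (1 - s ^ 2) * radial_energy a s - angular_energy a s) r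
    (2 * circ (fun t => j1 a r t * polar_op a r t)).
Proof.
  intros Ha Hp.
  rewrite (circ_polar_op a (j1 a)) by (assumption || apply j1_cont; assumption).
  rewrite circ_parts_1 by assumption.
  eapply is_derive_value.
  - apply (is_derive_minus (V := R_NormedModule)).
    + apply (is_derive_mult_R (fun s => s ^ 2 * (1 - s ^ 2)) (radial_energy a)).
      * instantiate (1 := 2 * (r - 2 * r ^ 3)). auto_derive; trivial; ring.
      * now apply is_derive_radial_energy.
    + now apply is_derive_angular_energy.
  - rewrite (circ_scal (fun r t => j1 a r t * j11 a r t)),
      (circ_scal (fun r t => j2 a r t * j12 a r t)) by cont2d.
    rewrite (circ_ext (fun t => j1 a r t * j1 a r t) (fun t => j1 a r t ^ 2))
      by (intros; ring).
    unfold minus, plus, opp; simpl. unfold radial_energy; simpl. ring.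
Qed.

(** * Equipartition and uniqueness *)

(** [cmc_center] says that the circle of radius [0] is a single point; it fixes the constant in the
    energy identity. *)
Record polar_cmc (a b c : jet) : Prop := {
  cmc_jet : is_jet a /\ is_jet b /\ is_jet c;
  cmc_periodic : periodic a /\ periodic b /\ periodic c;
  cmc_center : forall t, j2 a 0 t = 0 /\ j2 b 0 t = 0 /\ j2 c 0 t = 0;
  cmc_equation : forall r t,
    polar_op a r t = 2 * r * polar_cross b c r t /\
    polar_op b r t = 2 * r * polar_cross c a r t /\
    polar_op c r t = 2 * r * polar_cross a b r t }.

Lemma continuous_2d_polar_op (a : jet) : is_jet a -> continuous_2d (polar_op a).
Proof. intros Ha. unfold polar_op. cont2d. Qed.

Lemma circ_plus3 (f g h : R -> R -> R) (r : R) :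
  continuous_2d f -> continuous_2d g -> continuous_2d h ->
  circ (fun t => f r t + g r t + h r t) = circ (f r) + circ (g r) + circ (h r).
Proof.
  intros Hf Hg Hh.
  rewrite (circ_plus (fun r t => f r t + g r t) h) by cont2d.
  now rewrite circ_plus.
Qed.

Lemma equipartition (a b c : jet) (r : R) : polar_cmc a b c -> 0 <= r ->
  r ^ 2 * (1 - r ^ 2) * (radial_energy a r + radial_energy b r + radial_energy c r) =
  angular_energy a r + angular_energy b r + angular_energy c r.
Proof.
  intros [(Ha & Hb & Hc) (Pa & Pb & Pc) H0 Heq] Hr.
  set (k := fun a s => s ^ 2 * (1 - s ^ 2) * radial_energy a s - angular_energy a s).
  assert (Hk : forall s, is_derive (fun s => k a s + k b s + k c s) s 0).
  { intros s. eapply is_derive_value.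
    - apply (is_derive_plus_R (fun s => k a s + k b s) (k c));
        [apply (is_derive_plus_R (k a) (k b))|]; now apply is_derive_energy_difference.
    - rewrite <- !Rmult_plus_distr_l.
      rewrite <- (circ_plus3 (fun s t => j1 a s t * polar_op a s t)
        (fun s t => j1 b s t * polar_op b s t) (fun s t => j1 c s t * polar_op c s t));
        try (apply continuous_2d_mult; [now apply j1_cont|now apply continuous_2d_polar_op]).
      rewrite (circ_ext _ (fun _ => 0)).
      + rewrite circ_0. ring.
      (* The identity closed by [ring] is [f_r . (f_r x f_t) = 0]. *)
      + intros t. destruct (Heq s t) as (-> & -> & ->). unfold polar_cross. ring. }
  (* At the origin the factor [s ^ 2] removes the radial energy and [cmc_center] the angular one. *)
  assert (Hz : forall d, (forall t, j2 d 0 t = 0) -> k d 0 = 0).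
  { intros d Hd. unfold k, angular_energy.
    rewrite (circ_ext _ (fun _ => 0)); [rewrite circ_0; ring|].
    intros t. rewrite Hd. ring. }
  assert (E : k a r + k b r + k c r = 0).
  { rewrite <- (Rplus_0_r (_ + k c r)).
    destruct Hr as [Hr|<-].
    - rewrite <- (eq_is_derive (fun s => k a s + k b s + k c s) 0 r (fun s _ => Hk s) Hr).
      rewrite !Hz by (intros; apply H0). ring.
    - rewrite !Hz by (intros; apply H0). ring. }
  unfold k in E. lra.
Qed.

Lemma angular_energy_ge_0 (a : jet) (r : R) : is_jet a -> 0 <= angular_energy a r.
Proof.
  intros Ha. apply (circ_ge_0 (fun r t => j2 a r t ^ 2)); [cont2d|].
  intros; apply pow2_ge_0.
Qed.

Lemma mass_ge_0 (a : jet) (r : R) : is_jet a -> 0 <= mass a r.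
Proof.
  intros Ha. apply (circ_ge_0 (fun r t => j0 a r t ^ 2)); [cont2d|].
  intros; apply pow2_ge_0.
Qed.

(** A continuous [f_t ^ 2] of zero integral vanishes on the whole circle; the mean value theorem
    between [0] and [t] concludes. *)
Lemma constant_of_angular_energy (a : jet) (r : R) : is_jet a ->
  angular_energy a r = 0 -> forall t, - PI <= t <= PI -> j0 a r t = j0 a r 0.
Proof.
  intros Ha H t Ht. pose proof PI_RGT_0.
  destruct (MVT_gen (j0 a r) 0 t (j2 a r)) as (u & Hu & E).
  - intros u _. now apply j0_d2.
  - intros u _. apply derivable_continuous_pt. exists (j2 a r u).
    apply is_derive_Reals. now apply j0_d2.
  - assert (Hz : j2 a r u ^ 2 = 0).
    { apply (circ_eq_0 (fun r t => j2 a r t ^ 2)); [cont2d| |exact H|].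
      - intros; apply pow2_ge_0.
      - pose proof (Rmin_glb 0 t (- PI)). pose proof (Rmax_lub 0 t PI). lra. }
    rewrite <- Rsqr_pow2 in Hz. apply Rsqr_0_uniq in Hz. rewrite Hz in E. lra.
Qed.

Definition shift_jet (a : jet) (k : R) : jet :=
  Jet (fun x y => j0 a x y - k) (j1 a) (j2 a) (j11 a) (j12 a) (j22 a).

Lemma is_jet_shift (a : jet) (k : R) : is_jet a -> is_jet (shift_jet a k).
Proof.
  intros Ha. destruct Ha as [C0 C1 C2 C11 C12 C22 D1 D2 D11 D12 D21 D22].
  assert (E : forall l, l = l - 0) by (intros; ring).
  split; simpl; auto.
  - apply continuous_2d_minus; [assumption|apply continuous_2d_const].
  - intros x y. rewrite E. apply (is_derive_minus (V := R_NormedModule)); [apply D1|].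
    apply (is_derive_const (V := R_NormedModule)).
  - intros x y. rewrite E. apply (is_derive_minus (V := R_NormedModule)); [apply D2|].
    apply (is_derive_const (V := R_NormedModule)).
Qed.

Lemma periodic_shift (a : jet) (k : R) : periodic a -> periodic (shift_jet a k).
Proof. intros [H0 H1 H2]. split; simpl; auto. intros r; now rewrite H0. Qed.

(** The equation and the centre condition involve derivatives only. This permits subtracting the
    boundary value, which reduces uniqueness to zero boundary data. *)
Lemma polar_cmc_shift (a b c : jet) (ka kb kc : R) : polar_cmc a b c ->
  polar_cmc (shift_jet a ka) (shift_jet b kb) (shift_jet c kc).
Proof.
  intros [(Ha & Hb & Hc) (Pa & Pb & Pc) H0 Heq].
  split; auto using is_jet_shift, periodic_shift.
Qed.

(* AM-GM applied to [W . (f_r x f_t) = f_t . (W x f_r)], with Lagrange's identity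
   [|W x f_r|^2 <= |W|^2 |f_r|^2]. *)
Lemma triple_product_bound (w1 w2 w3 p1 p2 p3 q1 q2 q3 r S m : R) :
  0 <= r <= 1 -> 1 <= m -> p1 ^ 2 + p2 ^ 2 + p3 ^ 2 <= S ->
  - (m * S) * (w1 ^ 2 + w2 ^ 2 + w3 ^ 2) + - (4 / m) * (q1 ^ 2 + q2 ^ 2 + q3 ^ 2) <=
  2 * (w1 * (2 * r * (p2 * q3 - p3 * q2)) + w2 * (2 * r * (p3 * q1 - p1 * q3))
       + w3 * (2 * r * (p1 * q2 - p2 * q1))).
Proof.
  intros Hr Hm HS.
  set (y1 := w2 * p3 - w3 * p2). set (y2 := w3 * p1 - w1 * p3).
  set (y3 := w1 * p2 - w2 * p1).
  assert (Hy : y1 ^ 2 + y2 ^ 2 + y3 ^ 2 <= S * (w1 ^ 2 + w2 ^ 2 + w3 ^ 2)).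
  { apply Rle_trans with ((p1 ^ 2 + p2 ^ 2 + p3 ^ 2) * (w1 ^ 2 + w2 ^ 2 + w3 ^ 2)).
    - assert (0 <= (p1 * w1 + p2 * w2 + p3 * w3) ^ 2) by apply pow2_ge_0.
      unfold y1, y2, y3. nra.
    - apply Rmult_le_compat_r; [|assumption]. nra. }
  (* Completing the square leaves the remainder [m * y ^ 2 * (1 - r ^ 2)], nonnegative because
     [r <= 1]. *)
  assert (Hamgm : forall q y : R, 0 <= 4 / m * q ^ 2 + 4 * r * (q * y) + m * y ^ 2).
  { intros q y.
    assert (E : 4 / m * q ^ 2 + 4 * r * (q * y) + m * y ^ 2 =
      / m * ((2 * q + m * r * y) ^ 2 + (m * y) ^ 2 * (1 - r ^ 2))) by (field; lra).
    rewrite E. apply Rmult_le_pos; [left; apply Rinv_0_lt_compat; lra|].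
    apply Rplus_le_le_0_compat; [apply pow2_ge_0|].
    apply Rmult_le_pos; [apply pow2_ge_0|nra]. }
  pose proof (Hamgm q1 y1). pose proof (Hamgm q2 y2). pose proof (Hamgm q3 y3).
  assert (E : w1 * (2 * r * (p2 * q3 - p3 * q2)) + w2 * (2 * r * (p3 * q1 - p1 * q3))
       + w3 * (2 * r * (p1 * q2 - p2 * q1)) = 2 * r * (q1 * y1 + q2 * y2 + q3 * y3))
    by (unfold y1, y2, y3; ring).
  rewrite E. nra.
Qed.

(** Expansion of the integral of [(l f_r - q f) ^ 2]. With [- l] the derivative of the radius along
    the substitution, the middle coefficient is the derivative of the mass. *)
Lemma mass_quadratic (a : jet) (r l q : R) : is_jet a ->
  0 <= l ^ 2 * radial_energy a r
       + q * (- l * circ (fun t => 2 * (j0 a r t * j1 a r t))) + q ^ 2 * mass a r.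
Proof.
  intros Ha.
  assert (H : 0 <= circ (fun t => (l * j1 a r t - q * j0 a r t) ^ 2)).
  { apply (circ_ge_0 (fun r t => (l * j1 a r t - q * j0 a r t) ^ 2)); [cont2d|].
    intros; apply pow2_ge_0. }
  rewrite (circ_ext _ (fun t => l ^ 2 * j1 a r t ^ 2 + - (q * l) * (2 * (j0 a r t * j1 a r t))
    + q ^ 2 * j0 a r t ^ 2)) in H by (intros; ring).
  rewrite (circ_plus3 (fun r t => l ^ 2 * j1 a r t ^ 2)
    (fun r t => - (q * l) * (2 * (j0 a r t * j1 a r t)))
    (fun r t => q ^ 2 * j0 a r t ^ 2)) in H by cont2d.
  rewrite (circ_scal (fun r t => j1 a r t ^ 2)),
    (circ_scal (fun r t => 2 * (j0 a r t * j1 a r t))),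
    (circ_scal (fun r t => j0 a r t ^ 2)) in H by cont2d.
  unfold radial_energy, mass. lra.
Qed.

(** The equation turns the integrand on the right into a triple product, to which
    [triple_product_bound] applies at each angle with [W = f]. *)
Lemma circ_equation_bound (a b c : jet) (r m S : R) : polar_cmc a b c ->
  0 <= r <= 1 -> 1 <= m ->
  (forall t, - PI <= t <= PI -> j1 a r t ^ 2 + j1 b r t ^ 2 + j1 c r t ^ 2 <= S) ->
  - (m * S) * (mass a r + mass b r + mass c r)
  + - (4 / m) * (angular_energy a r + angular_energy b r + angular_energy c r) <=
  2 * (circ (fun t => j0 a r t * polar_op a r t) + circ (fun t => j0 b r t * polar_op b r t)
       + circ (fun t => j0 c r t * polar_op c r t)).
Proof.
  intros [(Ha & Hb & Hc) _ _ Heq] Hr Hm HS.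
  assert (Hop := continuous_2d_polar_op).
  unfold mass, angular_energy.
  rewrite <- (circ_plus3 (fun r t => j0 a r t * polar_op a r t)
    (fun r t => j0 b r t * polar_op b r t) (fun r t => j0 c r t * polar_op c r t)) by cont2d.
  rewrite <- (circ_plus3 (fun r t => j0 a r t ^ 2) (fun r t => j0 b r t ^ 2)
    (fun r t => j0 c r t ^ 2)) by cont2d.
  rewrite <- (circ_plus3 (fun r t => j2 a r t ^ 2) (fun r t => j2 b r t ^ 2)
    (fun r t => j2 c r t ^ 2)) by cont2d.
  rewrite <- (circ_scal (fun r t => j0 a r t * polar_op a r t + j0 b r t * polar_op b r t
    + j0 c r t * polar_op c r t)) by cont2d.
  rewrite <- (circ_scal (fun r t => j0 a r t ^ 2 + j0 b r t ^ 2 + j0 c r t ^ 2)) by cont2d.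
  rewrite <- (circ_scal (fun r t => j2 a r t ^ 2 + j2 b r t ^ 2 + j2 c r t ^ 2)) by cont2d.
  rewrite <- (circ_plus
    (fun r t => - (m * S) * (j0 a r t ^ 2 + j0 b r t ^ 2 + j0 c r t ^ 2))
    (fun r t => - (4 / m) * (j2 a r t ^ 2 + j2 b r t ^ 2 + j2 c r t ^ 2))) by cont2d.
  apply (circ_le
    (fun r t => - (m * S) * (j0 a r t ^ 2 + j0 b r t ^ 2 + j0 c r t ^ 2)
              + - (4 / m) * (j2 a r t ^ 2 + j2 b r t ^ 2 + j2 c r t ^ 2))
    (fun r t => 2 * (j0 a r t * polar_op a r t + j0 b r t * polar_op b r t
                     + j0 c r t * polar_op c r t))); try cont2d.
  intros t Ht. destruct (Heq r t) as (-> & -> & ->).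
  apply triple_product_bound; auto.
Qed.

(** * The hyperbolic substitution and unique continuation from the boundary *)

Lemma is_derive_sech (t : R) :
  is_derive (fun s => / cosh s) t (- (/ cosh t * (sinh t / cosh t))).
Proof.
  assert (Hc : cosh t <> 0).
  { unfold cosh. pose proof (exp_pos t). pose proof (exp_pos (- t)). lra. }
  eapply is_derive_value.
  - apply (is_derive_inv cosh t (sinh t)); [|exact Hc].
    apply is_derive_Reals, derivable_pt_lim_cosh.
  - field. exact Hc.
Qed.

Lemma is_derive_tanh (t : R) :
  is_derive (fun s => sinh s / cosh s) t (1 - (sinh t / cosh t) ^ 2).
Proof.
  assert (Hc : cosh t <> 0).
  { unfold cosh. pose proof (exp_pos t). pose proof (exp_pos (- t)). lra. }
  eapply is_derive_value.
  - apply (is_derive_div sinh cosh t (cosh t) (sinh t)); [| |exact Hc].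
    + apply is_derive_Reals, derivable_pt_lim_sinh.
    + apply is_derive_Reals, derivable_pt_lim_cosh.
  - field. exact Hc.
Qed.

Lemma cosh_ge_1 (t : R) : 1 <= cosh t.
Proof.
  pose proof (exp_pos t). pose proof (exp_pos (- t)).
  assert (exp t * exp (- t) = 1) by (rewrite <- exp_plus, Rplus_opp_r; apply exp_0).
  unfold cosh. apply Rnot_lt_le. intros Hlt.
  assert (0 < (2 - (exp t + exp (- t))) * (2 + (exp t + exp (- t))))
    by (apply Rmult_lt_0_compat; lra).
  pose proof (pow2_ge_0 (exp t - exp (- t))). nra.
Qed.

Lemma cosh_sqr (t : R) : cosh t ^ 2 = 1 + sinh t ^ 2.
Proof.
  assert (E : exp t * exp (- t) = 1) by (rewrite <- exp_plus, Rplus_opp_r; apply exp_0).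
  unfold cosh, sinh. lra.
Qed.

Lemma sech_bounds (t : R) : 0 < / cosh t <= 1.
Proof.
  pose proof (cosh_ge_1 t). split; [apply Rinv_0_lt_compat; lra|].
  rewrite <- Rinv_1. apply Rinv_le_contravar; lra.
Qed.

Lemma tanh_sech (t : R) : (sinh t / cosh t) ^ 2 = 1 - (/ cosh t) ^ 2.
Proof.
  pose proof (cosh_ge_1 t).
  assert (Hs : sinh t ^ 2 = cosh t ^ 2 - 1) by (rewrite cosh_sqr; ring).
  unfold Rdiv. rewrite Rpow_mult_distr, Hs. field. lra.
Qed.

Lemma sech_surjective (r : R) : 0 < r <= 1 -> exists t, 0 <= t /\ / cosh t = r.
Proof.
  intros Hr.
  assert (H1 : 1 <= / r) by (rewrite <- Rinv_1; apply Rinv_le_contravar; lra).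
  (* Chosen as the value of [sinh] for which [cosh ^ 2 = 1 + sinh ^ 2] equals [(/ r) ^ 2]. *)
  set (z := sqrt ((/ r) ^ 2 - 1)).
  assert (Hz : z ^ 2 = (/ r) ^ 2 - 1) by (apply pow2_sqrt; nra).
  exists (arcsinh z). split.
  - rewrite <- arcsinh_0. apply arcsinh_le. apply sqrt_pos.
  - pose proof (cosh_sqr (arcsinh z)) as E. rewrite sinh_arcsinh, Hz in E.
    assert (Hc := cosh_ge_1 (arcsinh z)).
    assert (E' : cosh (arcsinh z) = / r) by (apply Rsqr_inj; [lra|lra|rewrite !Rsqr_pow2; lra]).
    now rewrite E', Rinv_inv.
Qed.

Lemma radial_derivative_bounded (a b c : jet) : is_jet a -> is_jet b -> is_jet c ->
  exists S, 0 <= S /\ forall r t, 0 <= r <= 1 -> - PI <= t <= PI ->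
    j1 a r t ^ 2 + j1 b r t ^ 2 + j1 c r t ^ 2 <= S.
Proof.
  intros Ha Hb Hc. pose proof PI_RGT_0.
  destruct (continuous_2d_bounded
    (fun r t => j1 a r t ^ 2 + j1 b r t ^ 2 + j1 c r t ^ 2) 0 1 (- PI) PI) as [M HM];
    [cont2d|lra|lra|].
  exists M. split.
  - apply Rle_trans with (2 := HM 0 0 ltac:(lra) ltac:(lra)). apply Rabs_pos.
  - intros r t Hr Ht. apply Rle_trans with (2 := HM r t Hr Ht). apply Rle_abs.
Qed.

(* In the variable [t] with [r = sech t] the radial part of the equation becomes [d^2/dt^2]. *)
Lemma mass_zero_of_boundary (a b c : jet) : polar_cmc a b c ->
  mass a 1 = 0 -> mass b 1 = 0 -> mass c 1 = 0 ->
  forall r, 0 < r <= 1 -> mass a r + mass b r + mass c r = 0.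
Proof.
  intros Hcmc Ma Mb Mc r Hr.
  destruct (cmc_jet _ _ _ Hcmc) as (Ha & Hb & Hc).
  destruct (cmc_periodic _ _ _ Hcmc) as (Pa & Pb & Pc).
  destruct (radial_derivative_bounded a b c Ha Hb Hc) as (S & HS & Hbound).
  set (dm := fun a s => circ (fun t => 2 * (j0 a s t * j1 a s t))).
  set (ddm := fun a s => 2 * radial_energy a s + 2 * circ (fun t => j0 a s t * j11 a s t)).
  set (m0 := fun s => mass a s + mass b s + mass c s).
  set (m1 := fun s => dm a s + dm b s + dm c s).
  set (m2 := fun s => ddm a s + ddm b s + ddm c s).
  (* Here [rho' = - rho tau], [rho'^2 = rho^2 (1 - rho^2)] and [rho'' = rho - 2 rho^3]: exactly the
     radial coefficients of [polar_op]. *)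
  set (rho := fun t => / cosh t). set (tau := fun t => sinh t / cosh t).
  set (e := fun s => angular_energy a s + angular_energy b s + angular_energy c s).
  assert (Hm1 : forall s, is_derive m0 s (m1 s)).
  { intros s. apply (is_derive_plus_R (fun s => mass a s + mass b s) (mass c));
      [apply (is_derive_plus_R (mass a) (mass b))|]; now apply is_derive_mass. }
  assert (Hm2 : forall s, is_derive m1 s (m2 s)).
  { intros s. apply (is_derive_plus_R (fun s => dm a s + dm b s) (dm c));
      [apply (is_derive_plus_R (dm a) (dm b))|]; now apply is_derive_mass_2. }
  assert (Hrho : forall t, is_derive rho t (- (rho t * tau t))) by apply is_derive_sech.
  assert (Htau : forall t, is_derive tau t (1 - tau t ^ 2)) by apply is_derive_tanh.
  assert (Ht2 : forall t, tau t ^ 2 = 1 - rho t ^ 2) by apply tanh_sech.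
  assert (Hr01 : forall t, 0 < rho t <= 1) by apply sech_bounds.
  assert (He : forall t, e (rho t) = (rho t * tau t) ^ 2 *
    (radial_energy a (rho t) + radial_energy b (rho t) + radial_energy c (rho t))).
  { intros t. unfold e. rewrite <- (equipartition a b c (rho t) Hcmc) by (specialize (Hr01 t); lra).
    rewrite Rpow_mult_distr, Ht2. ring. }
  destruct (sech_surjective r Hr) as (T & HT & <-).
  apply (log_convex_unique_continuation (fun t => m0 (rho t))
    (fun t => - (rho t * tau t) * m1 (rho t))
    (fun t => (rho t * tau t) ^ 2 * m2 (rho t) + (rho t - 2 * rho t ^ 3) * m1 (rho t))
    (fun t => e (rho t)) S); auto.
  - intros t. apply (is_derive_comp m0 rho); auto.
  - intros t. eapply is_derive_value.
    + apply (is_derive_mult_R (fun t => - (rho t * tau t)) (fun t => m1 (rho t))).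
      * apply (is_derive_opp (V := R_NormedModule)).
        apply (is_derive_mult_R rho tau); auto.
      * apply (is_derive_comp m1 rho); auto.
    + unfold opp, scal, mult; simpl. unfold mult; simpl.
      transitivity ((rho t * tau t) ^ 2 * m2 (rho t) +
        rho t * (tau t ^ 2 - (1 - tau t ^ 2)) * m1 (rho t)); [ring|].
      rewrite Ht2. ring.
  - intros t. unfold m0.
    pose proof (mass_ge_0 a (rho t) Ha). pose proof (mass_ge_0 b (rho t) Hb).
    pose proof (mass_ge_0 c (rho t) Hc). lra.
  - intros t q _. rewrite He.
    pose proof (mass_quadratic a (rho t) (rho t * tau t) q Ha).
    pose proof (mass_quadratic b (rho t) (rho t * tau t) q Hb).
    pose proof (mass_quadratic c (rho t) (rho t * tau t) q Hc).
    unfold m0, m1, dm. lra.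
  (* The second derivative of the mass is [4 e] plus twice the integral of [f . polar_op f]: one
     [2 e] is the radial energy converted by equipartition, the other comes from integrating
     [f f_tt] by parts. *)
  - intros t m _ Hm. specialize (He t). specialize (Ht2 t). specialize (Hr01 t).
    unfold m2, m1, m0, ddm, dm, e in *. set (s := rho t) in *.
    pose proof (circ_equation_bound a b c s m S Hcmc ltac:(lra) Hm
      (fun u => Hbound s u ltac:(lra))) as Hb2.
    rewrite !circ_polar_op in Hb2 by (assumption || (apply j0_cont; assumption)).
    rewrite !circ_parts_0 in Hb2 by assumption.
    rewrite (circ_scal (fun s t => j0 a s t * j1 a s t)),
      (circ_scal (fun s t => j0 b s t * j1 b s t)),
      (circ_scal (fun s t => j0 c s t * j1 c s t)) by cont2d.
    replace ((s * tau t) ^ 2) with (s ^ 2 * (1 - s ^ 2)) in * by (rewrite <- Ht2; ring).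
    nra.
  - unfold m0, rho. rewrite cosh_0, Rinv_1, Ma, Mb, Mc. ring.
Qed.

Lemma polar_cmc_constant (a b c : jet) : polar_cmc a b c ->
  forall r t, 0 <= r <= 1 -> - PI <= t <= PI ->
  j0 a r t = j0 a 1 0 /\ j0 b r t = j0 b 1 0 /\ j0 c r t = j0 c 1 0.
Proof.
  intros Hcmc. pose proof PI_RGT_0.
  destruct (cmc_jet _ _ _ Hcmc) as (Ha & Hb & Hc).
  (* At [r = 1] the factor [1 - r ^ 2] vanishes, so three nonnegative energies sum to zero. *)
  assert (Hq : angular_energy a 1 = 0 /\ angular_energy b 1 = 0 /\ angular_energy c 1 = 0).
  { pose proof (equipartition a b c 1 Hcmc Rle_0_1).
    pose proof (angular_energy_ge_0 a 1 Ha). pose proof (angular_energy_ge_0 b 1 Hb).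
    pose proof (angular_energy_ge_0 c 1 Hc). lra. }
  set (a' := shift_jet a (j0 a 1 0)). set (b' := shift_jet b (j0 b 1 0)).
  set (c' := shift_jet c (j0 c 1 0)).
  assert (Hcmc' : polar_cmc a' b' c') by now apply polar_cmc_shift.
  destruct (cmc_jet _ _ _ Hcmc') as (Ha' & Hb' & Hc').
  assert (Hm1 : forall d, is_jet d -> angular_energy d 1 = 0 ->
    mass (shift_jet d (j0 d 1 0)) 1 = 0).
  { intros d Hd Hd0. transitivity (circ (fun _ => 0)); [apply RInt_ext|apply circ_0]. intros t Ht.
    rewrite Rmin_left, Rmax_right in Ht by lra.
    change ((j0 d 1 t - j0 d 1 0) ^ 2 = 0).
    rewrite (constant_of_angular_energy d 1 Hd Hd0 t) by lra. ring. }
  set (m0 := fun s => mass a' s + mass b' s + mass c' s).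
  destruct Hq as (Qa & Qb & Qc).
  assert (Hm : forall s, 0 < s <= 1 -> m0 s = 0)
    by exact (mass_zero_of_boundary a' b' c' Hcmc' (Hm1 a Ha Qa) (Hm1 b Hb Qb) (Hm1 c Hc Qc)).
  (* The hyperbolic secant never reaches [0], so the centre is obtained by continuity: a positive
     [m0 0] would persist at small positive radii. *)
  assert (Hm0 : m0 0 = 0).
  { assert (Hc0 : continuous m0 0).
    { apply (ex_derive_continuous (V := R_NormedModule)). eexists.
      apply (is_derive_plus_R (fun s => mass a' s + mass b' s) (mass c'));
        [apply (is_derive_plus_R (mass a') (mass b'))|]; now apply is_derive_mass. }
    assert (Hge : 0 <= m0 0).
    { pose proof (mass_ge_0 a' 0 Ha'). pose proof (mass_ge_0 b' 0 Hb').
      pose proof (mass_ge_0 c' 0 Hc'). unfold m0. lra. }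
    destruct Hge as [Hlt|Heq]; [exfalso|congruence].
    destruct (Hc0 (fun y => 0 < y)) as [d Hd]; [now apply (open_gt 0)|].
    assert (Hd0 := cond_pos d).
    assert (Hs : 0 < Rmin 1 (d / 2)) by (apply Rmin_glb_lt; lra).
    pose proof (Rmin_l 1 (d / 2)). pose proof (Rmin_r 1 (d / 2)).
    assert (Hpos : 0 < m0 (Rmin 1 (d / 2))).
    { apply Hd. apply Rabs_lt_between'. simpl. lra. }
    rewrite Hm in Hpos; lra. }
  intros r t Hr Ht.
  assert (Hmr : m0 r = 0) by (destruct (Req_dec r 0) as [->|]; [assumption|apply Hm; lra]).
  unfold m0 in Hmr.
  pose proof (mass_ge_0 a' r Ha'). pose proof (mass_ge_0 b' r Hb').
  pose proof (mass_ge_0 c' r Hc').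
  assert (Hz : forall d, is_jet d -> mass d r = 0 -> j0 d r t = 0).
  { intros d Hd Hd0.
    assert (Hsq : j0 d r t ^ 2 = 0).
    { apply (circ_eq_0 (fun r t => j0 d r t ^ 2)); auto; [cont2d|].
      intros; apply pow2_ge_0. }
    rewrite <- Rsqr_pow2 in Hsq. now apply Rsqr_0_uniq. }
  pose proof (Hz a' Ha' ltac:(lra)) as Ea. pose proof (Hz b' Hb' ltac:(lra)) as Eb.
  pose proof (Hz c' Hc' ltac:(lra)) as Ec. simpl in Ea, Eb, Ec.
  repeat split; lra.
Qed.

(** * Return to Cartesian coordinates *)

Lemma polar_coordinates (x y : R) :
  exists t, - PI <= t <= PI /\
    x = sqrt (x ^ 2 + y ^ 2) * cos t /\ y = sqrt (x ^ 2 + y ^ 2) * sin t.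
Proof.
  set (r := sqrt (x ^ 2 + y ^ 2)). pose proof PI_RGT_0.
  assert (Hr2 : r ^ 2 = x ^ 2 + y ^ 2) by (apply pow2_sqrt; nra).
  assert (Hr : 0 <= r) by apply sqrt_pos.
  destruct Hr as [Hr|Hr].
  - assert (Hx : -1 <= x / r <= 1).
    { assert (x / r * r = x) by (field; lra).
      assert (- r <= x <= r) by (split; nra).
      split; apply Rmult_le_reg_r with r; lra. }
    assert (Hsin : r * sin (acos (x / r)) = Rabs y).
    { rewrite sin_acos by assumption.
      rewrite <- (sqrt_pow2 r) at 1 by lra.
      rewrite <- sqrt_mult_alt by nra.
      replace (r ^ 2 * (1 - Rsqr (x / r))) with (y ^ 2).
      - rewrite <- Rsqr_pow2. apply sqrt_Rsqr_abs.
      - unfold Rsqr. transitivity (r ^ 2 - x ^ 2); [lra|]. field. lra. }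
    assert (Hcos : r * cos (acos (x / r)) = x) by (rewrite cos_acos by assumption; field; lra).
    pose proof (acos_bound (x / r)).
    (* [acos] only sees the upper half-plane; the sign of [y] selects the angle or its opposite. *)
    destruct (Rle_dec 0 y) as [Hy|Hy].
    + exists (acos (x / r)). rewrite Rabs_pos_eq in Hsin by assumption. lra.
    + exists (- acos (x / r)). rewrite cos_neg, sin_neg.
      rewrite Rabs_left in Hsin by lra. lra.
  - exists 0. rewrite <- Hr in *. split; [lra|]. nra.
Qed.

(** The angles [- PI] and [PI] give the same point, [cos] being even and [sin] zero at both. *)
Lemma periodic_polar (a : jet) : periodic (polar_jet a).
Proof.
  split; intros r; simpl; unfold polar; now rewrite cos_neg, sin_neg, sin_PI, Ropp_0.
Qed.

Theorem theorem2 (v : R -> R -> R3)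
  (hv : C2_plane v)
  (hu : wave_cmc_solution (self_similar v)) :
  exists c : R3, forall x y : R, unit_disc x y -> v x y = c.
Proof.
  set (a := jet_of (fun x y => comp1 (v x y))).
  set (b := jet_of (fun x y => comp2 (v x y))).
  set (c := jet_of (fun x y => comp3 (v x y))).
  assert (Ha : is_jet a) by (apply is_jet_jet_of; intros; apply hv).
  assert (Hb : is_jet b) by (apply is_jet_jet_of; intros; apply hv).
  assert (Hc : is_jet c) by (apply is_jet_jet_of; intros; apply hv).
  assert (Hv : forall x y, v x y = (j0 a x y, j0 b x y, j0 c x y))
    by (intros x y; simpl; now destruct (v x y) as [[? ?] ?]).
  assert (Hcmc : polar_cmc (polar_jet a) (polar_jet b) (polar_jet c)).
  { split; auto using is_jet_polar, periodic_polar.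
    (* The angular derivative in [polar_jet] carries an explicit factor [r]. *)
    - intros t. simpl. rewrite !Rmult_0_l. auto.
    - intros r t. rewrite !polar_op_polar_jet, !polar_cross_polar_jet.
      destruct (klein_equation v a b c Ha Hb Hc Hv hu (r * cos t) (r * sin t))
        as (-> & -> & ->).
      repeat split; ring. }
  (* The constant is the value at the boundary point [(1, 0)], kept in polar form to match
     [polar_cmc_constant]. *)
  exists (v (1 * cos 0) (1 * sin 0)). intros x y Hxy.
  destruct (polar_coordinates x y) as (t & Ht & Ex & Ey).
  set (r := sqrt (x ^ 2 + y ^ 2)) in *.
  assert (Hr : 0 <= r <= 1).
  { split; [apply sqrt_pos|]. rewrite <- sqrt_1. apply sqrt_le_1_alt.
    unfold unit_disc in Hxy. lra. }
  destruct (polar_cmc_constant _ _ _ Hcmc r t Hr Ht) as (E1 & E2 & E3).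
  cbn [polar_jet j0] in E1, E2, E3. unfold polar in E1, E2, E3.
  rewrite !Hv, <- E1, <- E2, <- E3. now rewrite <- Ex, <- Ey.
Qed.
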